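(* Let $n,d\ge1$ be integers. Let $\Lambda_n^{(d)}$ be the $\mathbb{Q}$-vector space of symmetric polynomials in $x_1,\dots,x_n$ whose degree in each variable does not exceed $d$, regarded as an $\mathfrak{sl}_2$-module via $$\mathfrak{e}_+\mapsto\sum_{k=1}^n\Big(-x_k^2\frac{\partial}{\partial x_k}+d\,x_k\Big),\qquad \mathfrak{h}\mapsto 2\sum_{k=1}^n x_k\frac{\partial}{\partial x_k}-nd,\qquad \mathfrak{e}_-\mapsto\sum_{k=1}^n\frac{\partial}{\partial x_k}.$$ Then there is an isomorphism of $\mathfrak{sl}_2$-modules $$\Lambda_n^{(d)}\cong\bigoplus_{i=0}^{nd}c_n(d,i)\,V_i,$$ where $$c_n(d,i)=\gamma\Big(d+n,n,\tfrac12dn-\tfrac12i\Big)-\gamma\Big(d+n,n,\tfrac12dn-\tfrac12i-1\Big),$$ and $\gamma(m,n,j)$ denotes the coefficient of $T^j$ in $$\frac{(1-T^{m-n+1})\cdots(1-T^m)}{(1-T)\cdots(1-T^n)},$$ so that $\gamma(d+n,n,j)$ is the number of partitions of size $j$ inside the $d\times n$ rectangle.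
   Context: $\mathfrak{sl}_2$ has basis $\mathfrak{e}_-,\mathfrak{h},\mathfrak{e}_+$ with $[\mathfrak{h},\mathfrak{e}_+]=2\mathfrak{e}_+$, $[\mathfrak{h},\mathfrak{e}_-]=-2\mathfrak{e}_-$, $[\mathfrak{e}_+,\mathfrak{e}_-]=\mathfrak{h}$; an $\mathfrak{sl}_2$-module is a $\mathbb{Q}$-vector space with three endomorphisms (the images of these basis elements) satisfying these relations. The operators above preserve $\Lambda_n^{(d)}$ and satisfy the relations. $V_i$ denotes the standard irreducible $\mathfrak{sl}_2$-module of dimension $i+1$, with basis $v_0,\dots,v_i$ and action $\mathfrak{e}_+v_j=(i-j)v_{j+1}$, $\mathfrak{h}v_j=(2j-i)v_j$, $\mathfrak{e}_-v_j=j\,v_{j-1}$ (with $v_{-1}=v_{i+1}=0$). $c\,V_i$ denotes the direct sum of $c$ copies of $V_i$. By convention $\gamma(m,n,j)=0$ when $j$ is negative or not an integer. *)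

(* Defs.v *)
From HB Require Import structures.
From mathcomp Require Import all_boot all_order all_fingroup all_algebra.
From mathcomp Require Import ring.
From mathcomp Require Export mpoly.

Set Implicit Arguments.
Unset Strict Implicit.
Unset Printing Implicit Defensive.

Import Order.TTheory GRing.Theory Num.Theory.
Local Open Scope ring_scope.

Record sl2Module := Sl2Module {
  sl2_sort :> lmodType rat;
  sl2_ep : {linear sl2_sort -> sl2_sort};
  sl2_h : {linear sl2_sort -> sl2_sort};
  sl2_em : {linear sl2_sort -> sl2_sort};
  sl2_hep : forall v, sl2_h (sl2_ep v) - sl2_ep (sl2_h v) = 2 *: sl2_ep v;
  sl2_hem : forall v, sl2_h (sl2_em v) - sl2_em (sl2_h v) = - 2 *: sl2_em v;
  sl2_epem : forall v, sl2_ep (sl2_em v) - sl2_em (sl2_ep v) = sl2_h v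
}.
Arguments sl2_ep {s}.
Arguments sl2_h {s}.
Arguments sl2_em {s}.

Definition sl2_iso (M N : sl2Module) : Prop :=
  exists phi : {linear M -> N},
    [/\ bijective phi,
        forall v, phi (sl2_ep v) = sl2_ep (phi v),
        forall v, phi (sl2_h v) = sl2_h (phi v)
      & forall v, phi (sl2_em v) = sl2_em (phi v)].

(* Finite direct sums: since the index set I is finite, the direct sum is the
   product. The library has no module structure on dependent finite functions. *)
Section DirectSumSpace.
Variables (I : finType) (M : I -> lmodType rat).

Definition dsum : Type := {dffun forall i : I, M i}.
HB.instance Definition _ := Choice.on dsum.

Implicit Types u v : dsum.

Definition dsum_mk (F : forall i, M i) : dsum := [ffun i => F i].
Definition dsum_coord v (i : I) : M i := v i.

Lemma dsumE F i : dsum_coord (dsum_mk F) i = F i.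
Proof. exact: ffunE. Qed.

Lemma dsumP u v : (forall i, dsum_coord u i = dsum_coord v i) -> u = v.
Proof. by move=> uv; apply/ffunP. Qed.

Definition dsum_add u v := dsum_mk (fun i => dsum_coord u i + dsum_coord v i).
Definition dsum_opp v := dsum_mk (fun i => - dsum_coord v i).
Definition dsum_scale (a : rat) v := dsum_mk (fun i => a *: dsum_coord v i).

Fact dsum_addA : associative dsum_add.
Proof. by move=> u v w; apply: dsumP => i; rewrite !dsumE addrA. Qed.
Fact dsum_addC : commutative dsum_add.
Proof. by move=> u v; apply: dsumP => i; rewrite !dsumE addrC. Qed.
Fact dsum_add0 : left_id (dsum_mk (fun=> 0)) dsum_add.
Proof. by move=> u; apply: dsumP => i; rewrite !dsumE add0r. Qed.
Fact dsum_addN : left_inverse (dsum_mk (fun=> 0)) dsum_opp dsum_add.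
Proof. by move=> u; apply: dsumP => i; rewrite !dsumE addNr. Qed.
HB.instance Definition _ :=
  GRing.isZmodule.Build dsum dsum_addA dsum_addC dsum_add0 dsum_addN.

Fact dsum_scaleA a b v : dsum_scale a (dsum_scale b v) = dsum_scale (a * b) v.
Proof. by apply: dsumP => i; rewrite !dsumE scalerA. Qed.
Fact dsum_scale1 : left_id 1 dsum_scale.
Proof. by move=> u; apply: dsumP => i; rewrite !dsumE scale1r. Qed.
Fact dsum_scaleDr : right_distributive dsum_scale +%R.
Proof. by move=> a u v; apply: dsumP => i; rewrite !dsumE scalerDr. Qed.
Fact dsum_scaleDl v : {morph dsum_scale^~ v : a b / a + b}.
Proof. by move=> a b; apply: dsumP => i; rewrite !dsumE scalerDl. Qed.
HB.instance Definition _ := GRing.Zmodule_isLmodule.Build rat dsum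
  dsum_scaleA dsum_scale1 dsum_scaleDr dsum_scaleDl.

Lemma dsum_coordD u v i :
  dsum_coord (u + v) i = dsum_coord u i + dsum_coord v i.
Proof. exact: dsumE. Qed.
Lemma dsum_coordN v i : dsum_coord (- v) i = - dsum_coord v i.
Proof. exact: dsumE. Qed.
Lemma dsum_coordZ a v i : dsum_coord (a *: v) i = a *: dsum_coord v i.
Proof. exact: dsumE. Qed.

Section Map.
Variable f : forall i, {linear M i -> M i}.

Definition dsum_map v : dsum := dsum_mk (fun i => f i (dsum_coord v i)).

Fact dsum_map_is_linear : linear dsum_map.
Proof.
move=> a u v; apply: dsumP => i.
by rewrite !dsumE linearP.
Qed.
HB.instance Definition _ :=
  GRing.isLinear.Build rat dsum dsum *:%R dsum_map dsum_map_is_linear.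
End Map.

End DirectSumSpace.

Section DirectSum.
Variables (I : finType) (M : I -> sl2Module).

Local Notation D := (dsum (fun i => M i : lmodType rat)).
Definition sl2_dsum_ep : {linear D -> D} := dsum_map (fun i => @sl2_ep (M i)).
Definition sl2_dsum_h : {linear D -> D} := dsum_map (fun i => @sl2_h (M i)).
Definition sl2_dsum_em : {linear D -> D} := dsum_map (fun i => @sl2_em (M i)).
Local Notation ep := sl2_dsum_ep.
Local Notation h := sl2_dsum_h.
Local Notation em := sl2_dsum_em.

Fact sl2_dsum_hep v : h (ep v) - ep (h v) = 2 *: ep v.
Proof.
apply: dsumP => i.
by rewrite dsum_coordD dsum_coordN dsum_coordZ !dsumE sl2_hep.
Qed.
Fact sl2_dsum_hem v : h (em v) - em (h v) = - 2 *: em v.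
Proof.
apply: dsumP => i.
by rewrite dsum_coordD dsum_coordN dsum_coordZ !dsumE sl2_hem.
Qed.
Fact sl2_dsum_epem v : ep (em v) - em (ep v) = h v.
Proof.
apply: dsumP => i.
by rewrite dsum_coordD dsum_coordN !dsumE sl2_epem.
Qed.

Definition sl2_dsum := Sl2Module sl2_dsum_hep sl2_dsum_hem sl2_dsum_epem.
End DirectSum.

Definition sl2_copies (c : nat) (M : sl2Module) : sl2Module :=
  sl2_dsum (fun _ : 'I_c => M).

Section StandardModule.
Variable i : nat.

(* The bounds j <= i are not enforced: std_v j = 0 for j > i. *)
Definition std_v (j : nat) : 'rV[rat]_i.+1 := \row_k (k == j :> nat)%:R.

(* The matrices act on row vectors on the right, so row j is the image of v_j.
   At j = 0 the truncated j.-1 is harmless because of the factor j. *)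
Definition std_ep_mx : 'M[rat]_i.+1 :=
  \matrix_j ((i%:R - j%:R) *: std_v j.+1).
Definition std_h_mx : 'M[rat]_i.+1 :=
  \matrix_j ((2 * j%:R - i%:R) *: std_v j).
Definition std_em_mx : 'M[rat]_i.+1 :=
  \matrix_j (j%:R *: std_v j.-1).

Definition std_ep : {linear 'rV[rat]_i.+1 -> 'rV[rat]_i.+1} := mulmxr std_ep_mx.
Definition std_h : {linear 'rV[rat]_i.+1 -> 'rV[rat]_i.+1} := mulmxr std_h_mx.
Definition std_em : {linear 'rV[rat]_i.+1 -> 'rV[rat]_i.+1} := mulmxr std_em_mx.
Local Notation ep := std_ep.
Local Notation h := std_h.
Local Notation em := std_em.

Lemma std_v_mul (A : nat -> 'rV[rat]_i.+1) j : (j < i.+1)%N ->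
  std_v j *m (\matrix_(k < i.+1) A k) = A j.
Proof.
move=> lt_ji; have -> : std_v j = delta_mx 0 (Ordinal lt_ji).
  by apply/rowP => k; rewrite !mxE eqxx -val_eqE.
by rewrite -rowE rowK.
Qed.

Lemma std_v_big j : (i < j)%N -> std_v j = 0.
Proof.
move=> lt_ij; apply/rowP => k; rewrite !mxE; case: eqP => // kj.
by have := ltn_ord k; rewrite kj ltnS leqNgt lt_ij.
Qed.

Lemma std_ep_v j : ep (std_v j) = (i%:R - j%:R) *: std_v j.+1.
Proof.
have [lt_ij | le_ji] := ltnP i j.
  by rewrite !std_v_big ?linear0 ?scaler0 // ltnW.
exact: (std_v_mul (fun k => (i%:R - k%:R) *: std_v k.+1)).
Qed.

Lemma std_h_v j : h (std_v j) = (2 * j%:R - i%:R) *: std_v j.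
Proof.
have [lt_ij | le_ji] := ltnP i j; first by rewrite std_v_big ?linear0 ?scaler0.
exact: (std_v_mul (fun k => (2 * k%:R - i%:R) *: std_v k)).
Qed.

Lemma std_em_v j : (j <= i)%N -> em (std_v j) = j%:R *: std_v j.-1.
Proof. exact: (std_v_mul (fun k => k%:R *: std_v k.-1)). Qed.

Fact std_epZ a v : ep (a *: v) = a *: ep v. Proof. exact: linearZ. Qed.
Fact std_hZ a v : h (a *: v) = a *: h v. Proof. exact: linearZ. Qed.
Fact std_emZ a v : em (a *: v) = a *: em v. Proof. exact: linearZ. Qed.

Lemma std_ext (f g : {linear 'rV[rat]_i.+1 -> 'rV[rat]_i.+1}) :
  (forall j, (j <= i)%N -> f (std_v j) = g (std_v j)) -> f =1 g.
Proof.
move=> fg v; rewrite (row_sum_delta v) !linear_sum; apply: eq_bigr => k _.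
rewrite !linearZ; congr (_ *: _); have := fg k (ltn_ord k).
suff -> : std_v k = delta_mx 0 k by [].
by apply/rowP => l; rewrite !mxE eqxx -val_eqE.
Qed.

Fact std_hep v : h (ep v) - ep (h v) = 2 *: ep v.
Proof.
move: v; apply: (@std_ext ((h \o ep) \- (ep \o h)) (2 \*: ep)) => j _.
change (h (ep (std_v j)) - ep (h (std_v j)) = 2 *: ep (std_v j)).
rewrite std_ep_v std_h_v std_hZ std_epZ std_ep_v std_h_v !scalerA -scalerBl.
by congr (_ *: _); rewrite -natr1; ring.
Qed.

Fact std_hem v : h (em v) - em (h v) = - 2 *: em v.
Proof.
move: v; apply: (@std_ext ((h \o em) \- (em \o h)) ((- 2) \*: em)) => j le_ji.
change (h (em (std_v j)) - em (h (std_v j)) = (- 2) *: em (std_v j)).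
rewrite std_h_v std_emZ std_em_v // std_hZ std_h_v !scalerA -scalerBl.
congr (_ *: _); case: j {le_ji} => [|j] /=; first by ring.
by rewrite -natr1; ring.
Qed.

Fact std_epem v : ep (em v) - em (ep v) = h v.
Proof.
move: v; apply: (@std_ext ((ep \o em) \- (em \o ep)) h) => j le_ji.
change (ep (em (std_v j)) - em (ep (std_v j)) = h (std_v j)).
rewrite std_ep_v std_h_v std_em_v // std_epZ std_emZ std_ep_v.
have -> : (i%:R - j%:R) *: em (std_v j.+1)
          = ((i%:R - j%:R) * j.+1%:R) *: std_v j.
  move: le_ji; rewrite leq_eqVlt => /predU1P[-> | lt_ji].
    by rewrite subrr mul0r !scale0r.
  by rewrite std_em_v // scalerA.
case: j {le_ji} => [|j] /=.
  by rewrite scale0r sub0r -scaleNr; congr (_ *: _); ring.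
rewrite scalerA -scalerBl; congr (_ *: _).
by rewrite -!natr1; ring.
Qed.

Definition sl2_V := Sl2Module std_hep std_hem std_epem.
End StandardModule.

Section Lambda.
Variables n d : nat.
Implicit Type p : {mpoly rat[n]}.

Definition pol_ep p : {mpoly rat[n]} :=
  \sum_(k < n) (- ('X_k ^+ 2 * p^`M(k)) + d%:R *: ('X_k * p)).
Definition pol_h p : {mpoly rat[n]} :=
  2 *: (\sum_(k < n) 'X_k * p^`M(k)) - (n * d)%:R *: p.
Definition pol_em p : {mpoly rat[n]} := \sum_(k < n) p^`M(k).

Fact pol_ep_is_linear : linear pol_ep.
Proof.
move=> a p q; rewrite /pol_ep scaler_sumr -big_split; apply: eq_bigr => k _ /=.
rewrite linearP !mulrDr -!scalerAr !scalerDr !scalerN opprD.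
by rewrite addrACA !scalerA [d%:R * a]mulrC.
Qed.
HB.instance Definition _ := GRing.isLinear.Build rat {mpoly rat[n]}
  {mpoly rat[n]} *:%R pol_ep pol_ep_is_linear.

Fact pol_h_is_linear : linear pol_h.
Proof.
move=> a p q; rewrite /pol_h.
under eq_bigr => k _ do rewrite linearP mulrDr -scalerAr.
rewrite big_split /= -scaler_sumr !scalerDr !scalerN opprD addrACA.
by rewrite !scalerA [2 * a]mulrC [_ * a]mulrC.
Qed.
HB.instance Definition _ := GRing.isLinear.Build rat {mpoly rat[n]}
  {mpoly rat[n]} *:%R pol_h pol_h_is_linear.

Fact pol_em_is_linear : linear pol_em.
Proof.
move=> a p q; rewrite /pol_em scaler_sumr -big_split.
by apply: eq_bigr => k _ /=; rewrite linearP.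
Qed.
HB.instance Definition _ := GRing.isLinear.Build rat {mpoly rat[n]}
  {mpoly rat[n]} *:%R pol_em pol_em_is_linear.

Lemma mpoly_linear_ext (f g : {linear {mpoly rat[n]} -> {mpoly rat[n]}}) :
  (forall m, f 'X_[m] = g 'X_[m]) -> f =1 g.
Proof.
move=> fg p; rewrite (mpolyE p) !linear_sum; apply: eq_bigr => m _.
by rewrite !linearZ fg.
Qed.

Lemma mulX_mderivX k m :
  'X_k * ('X_[m])^`M(k) = (m k)%:R *: 'X_[m] :> {mpoly rat[n]}.
Proof.
rewrite mderivX -scalerAr -mpolyXD; have [-> | mk] := eqVneq (m k) 0%N.
  by rewrite !scale0r.
congr (_ *: 'X_[_]); apply/mnmP => l; rewrite !mnmE.
by case: eqP => [<-|]; rewrite ?subn0 ?add0n // subnKC // lt0n.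
Qed.

Lemma pol_epX m :
  pol_ep 'X_[m] = \sum_(k < n) (d%:R - (m k)%:R) *: 'X_[m + U_(k)].
Proof.
apply: eq_bigr => k _; rewrite expr2 -mulrA mulX_mderivX -scalerAr.
by rewrite -mpolyXD addmC scalerBl addrC.
Qed.

Lemma pol_hX m :
  pol_h 'X_[m] = (2 * (mdeg m)%:R - (n * d)%:R) *: 'X_[m].
Proof.
rewrite /pol_h; under eq_bigr => k _ do rewrite mulX_mderivX.
by rewrite -scaler_suml scalerA scalerBl mdegE natr_sum.
Qed.

Lemma pol_emX m :
  pol_em 'X_[m] = \sum_(k < n) (m k)%:R *: 'X_[m - U_(k)].
Proof. by apply: eq_bigr => k _; rewrite mderivX. Qed.

Definition deg_le_pred : {pred {mpoly rat[n]}} :=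
  fun p => all (fun m : 'X_{1..n} => [forall k, (m k <= d)%N]) (msupp p).

Lemma deg_leP p :
  reflect (forall m : 'X_{1..n}, m \in msupp p -> forall k, (m k <= d)%N)
          (p \in deg_le_pred).
Proof.
by apply: (iffP allP) => H m /H; [move/forallP | move=> ?; apply/forallP].
Qed.

Fact deg_le_submod_closed : submod_closed deg_le_pred.
Proof.
split=> [|a p q /deg_leP pd /deg_leP qd]; first by apply/deg_leP; rewrite msupp0.
apply/deg_leP => m /msuppD_le; rewrite mem_cat.
by case/orP => [/msuppZ_le /pd | /qd].
Qed.
HB.instance Definition _ := GRing.isSubmodClosed.Build rat {mpoly rat[n]}
  deg_le_pred deg_le_submod_closed.

Definition Lambda_pred : {pred {mpoly rat[n]}} :=
  fun p => (p \is symmetric) && (p \in deg_le_pred).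

Fact Lambda_submod_closed : submod_closed Lambda_pred.
Proof.
split=> [|a p q /andP[ps pd] /andP[qs qd]]; apply/andP.
  by split; apply: rpred0.
by split; apply: rpredD => //; apply: rpredZ.
Qed.
HB.instance Definition _ := GRing.isSubmodClosed.Build rat {mpoly rat[n]}
  Lambda_pred Lambda_submod_closed.

Lemma pol_hep p : pol_h (pol_ep p) - pol_ep (pol_h p) = 2 *: pol_ep p.
Proof.
move: p; apply: (@mpoly_linear_ext ((pol_h \o pol_ep) \- (pol_ep \o pol_h))
                                   (2 \*: pol_ep)) => m /=.
rewrite pol_hX linearZ /= pol_epX linear_sum /= !scaler_sumr -sumrB.
apply: eq_bigr => k _; rewrite linearZ /= pol_hX !scalerA -scalerBl.
congr (_ *: _); rewrite mdegD mdeg1 natrD; ring.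
Qed.

Lemma pol_hem p : pol_h (pol_em p) - pol_em (pol_h p) = - 2 *: pol_em p.
Proof.
move: p; apply: (@mpoly_linear_ext ((pol_h \o pol_em) \- (pol_em \o pol_h))
                                   ((- 2) \*: pol_em)) => m /=.
rewrite pol_hX linearZ /= pol_emX linear_sum /= !scaler_sumr -sumrB.
apply: eq_bigr => k _; rewrite linearZ /= pol_hX !scalerA -scalerBl.
congr (_ *: _); have [-> | mk] := eqVneq (m k) 0%N; first by ring.
have <- : (mdeg (m - U_(k)) + 1 = mdeg m)%N.
  rewrite -(mdeg1 k) -mdegD submK //.
  by apply/mnm_lepP => l; rewrite mnm1E; case: eqP => // <-; rewrite lt0n.
rewrite natrD; ring.
Qed.

Lemma pol_epem p : pol_ep (pol_em p) - pol_em (pol_ep p) = pol_h p.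
Proof.
move: p; apply: (@mpoly_linear_ext ((pol_ep \o pol_em) \- (pol_em \o pol_ep))
                                   pol_h) => m /=.
have -> : pol_ep (pol_em 'X_[m]) = \sum_(k < n) \sum_(l < n)
    ((m l)%:R * (d%:R - ((m - U_(l))%MM k)%:R)) *: 'X_[m - U_(l) + U_(k)].
  rewrite pol_emX linear_sum [RHS]exchange_big; apply: eq_bigr => l _ /=.
  rewrite linearZ /= pol_epX scaler_sumr.
  by apply: eq_bigr => k _; rewrite scalerA.
have -> : pol_em (pol_ep 'X_[m]) = \sum_(k < n) \sum_(l < n)
    ((d%:R - (m k)%:R) * ((m + U_(k))%MM l)%:R) *: 'X_[m + U_(k) - U_(l)].
  rewrite pol_epX linear_sum; apply: eq_bigr => k _ /=.
  rewrite linearZ /= pol_emX scaler_sumr.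
  by apply: eq_bigr => l _; rewrite scalerA.
rewrite -sumrB pol_hX mdegE natr_sum mulr_sumr natrM.
have -> : n%:R * d%:R = \sum_(k < n) d%:R :> rat.
  by rewrite sumr_const card_ord mulr_natl.
rewrite -sumrB scaler_suml; apply: eq_bigr => k _.
rewrite -sumrB (bigD1 k) //= big1 ?addr0 => [|l neq_lk].
  rewrite mnmDE mnmBE mnm1E eqxx addmK -[nat_of_bool true]/1%N.
  have [mk0 | mk] := eqVneq (m k) 0%N.
    by rewrite mk0 mul0r scale0r sub0r -scaleNr; congr (_ *: _); ring.
  rewrite submK; last first.
    by apply/mnm_lepP => l; rewrite mnm1E; case: eqP => // <-; rewrite lt0n.
  rewrite -scalerBl; congr (_ *: _).
  by rewrite natrD natrB ?lt0n //; ring.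
rewrite mnmDE mnmBE !mnm1E (negbTE neq_lk) eq_sym (negbTE neq_lk) subn0 addn0.
have [-> | ml] := eqVneq (m l) 0%N; first by rewrite mul0r mulr0 !scale0r subrr.
rewrite [X in X *: _]mulrC; apply/eqP; rewrite subr_eq0; apply/eqP.
congr (_ *: 'X_[_]); apply/mnmP => j; rewrite !mnmE.
case: (eqVneq l j) => [<-|_]; last by rewrite !subn0.
by rewrite eq_sym (negbTE neq_lk) !addn0.
Qed.

Lemma msym_mnmD1 (s : 'S_n) (m : 'X_{1..n}) k :
  ([multinom (m + U_(k))%MM (s i) | i < n]
   = [multinom m (s i) | i < n] + U_((s^-1)%g k))%MM.
Proof.
by apply/mnmP => j; rewrite !mnmE; congr (_ + (_ : bool))%N; apply/eqP/eqP=> [->|<-];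
  rewrite ?permK ?permKV.
Qed.

Lemma msym_mnmB1 (s : 'S_n) (m : 'X_{1..n}) k :
  ([multinom (m - U_(k))%MM (s i) | i < n]
   = [multinom m (s i) | i < n] - U_((s^-1)%g k))%MM.
Proof.
by apply/mnmP => j; rewrite !mnmE; congr (_ - (_ : bool))%N; apply/eqP/eqP=> [->|<-];
  rewrite ?permK ?permKV.
Qed.

Lemma msym_pol_ep s p : msym s (pol_ep p) = pol_ep (msym s p).
Proof.
move: p; apply: (@mpoly_linear_ext (msym s \o pol_ep) (pol_ep \o msym s)) => m /=.
rewrite msymX !pol_epX linear_sum [RHS](reindex_inj (@perm_inj _ s)) /=.
apply: eq_bigr => k _; rewrite linearZ /= msymX msym_mnmD1.
by rewrite mnmE invgK permK.
Qed.

Lemma msym_pol_h s p : msym s (pol_h p) = pol_h (msym s p).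
Proof.
move: p; apply: (@mpoly_linear_ext (msym s \o pol_h) (pol_h \o msym s)) => m /=.
by rewrite msymX !pol_hX linearZ /= msymX mdeg_mperm.
Qed.

Lemma msym_pol_em s p : msym s (pol_em p) = pol_em (msym s p).
Proof.
move: p; apply: (@mpoly_linear_ext (msym s \o pol_em) (pol_em \o msym s)) => m /=.
rewrite msymX !pol_emX linear_sum [RHS](reindex_inj (@perm_inj _ s)) /=.
apply: eq_bigr => k _; rewrite linearZ /= msymX msym_mnmB1.
by rewrite mnmE invgK permK.
Qed.

Lemma deg_leX (m : 'X_{1..n}) : (forall k, (m k <= d)%N) -> 'X_[m] \in deg_le_pred.
Proof. by move=> md; apply/deg_leP => m'; rewrite msuppX inE => /eqP ->. Qed.

Lemma deg_le_linear (f : {linear {mpoly rat[n]} -> {mpoly rat[n]}}) :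
    (forall m : 'X_{1..n}, (forall k, (m k <= d)%N) ->
       f 'X_[m] \in deg_le_pred) ->
  {homo f : p / p \in deg_le_pred}.
Proof.
move=> fX p /deg_leP pd; rewrite (mpolyE p) linear_sum big_seq.
by apply: rpred_sum => m /pd md; rewrite linearZ rpredZ ?fX.
Qed.

Fact Lambda_ep p : p \in Lambda_pred -> pol_ep p \in Lambda_pred.
Proof.
case/andP => /issymP ps pd; apply/andP; split.
  by apply/issymP => s; rewrite msym_pol_ep ps.
move: p pd {ps}; apply: (@deg_le_linear pol_ep) => m md /=.
rewrite pol_epX; apply: rpred_sum => k _; have [mk | mk] := eqVneq (m k) d.
  by rewrite mk subrr scale0r rpred0.
apply/rpredZ/deg_leX => l; rewrite mnmDE mnm1E.
by case: eqP => [<-|_]; rewrite ?addn0 // addn1 ltn_neqAle mk md.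
Qed.

Fact Lambda_h p : p \in Lambda_pred -> pol_h p \in Lambda_pred.
Proof.
case/andP => /issymP ps pd; apply/andP; split.
  by apply/issymP => s; rewrite msym_pol_h ps.
move: p pd {ps}; apply: (@deg_le_linear pol_h) => m md /=.
by rewrite pol_hX; apply/rpredZ/deg_leX.
Qed.

Fact Lambda_em p : p \in Lambda_pred -> pol_em p \in Lambda_pred.
Proof.
case/andP => /issymP ps pd; apply/andP; split.
  by apply/issymP => s; rewrite msym_pol_em ps.
move: p pd {ps}; apply: (@deg_le_linear pol_em) => m md /=.
rewrite pol_emX; apply: rpred_sum => k _; apply/rpredZ/deg_leX => l.
by rewrite mnmBE (leq_trans (leq_subr _ _)).
Qed.

Record Lambda := MkLambda {
  Lambda_val :> {mpoly rat[n]};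
  Lambda_valP : Lambda_val \in Lambda_pred
}.
HB.instance Definition _ := [isSub for Lambda_val].
HB.instance Definition _ := [Choice of Lambda by <:].
HB.instance Definition _ := [SubChoice_isSubLmodule of Lambda by <:].

Section Restrict.
Variable f : {linear {mpoly rat[n]} -> {mpoly rat[n]}}.
Hypothesis fL : forall p, p \in Lambda_pred -> f p \in Lambda_pred.

Definition Lambda_restr (u : Lambda) : Lambda := MkLambda (fL (Lambda_valP u)).

Fact Lambda_restr_is_linear : linear Lambda_restr.
Proof. by move=> a u v; apply: val_inj; rewrite /= linearP. Qed.
HB.instance Definition _ := GRing.isLinear.Build rat Lambda Lambda *:%R
  Lambda_restr Lambda_restr_is_linear.
End Restrict.

Definition Lambda_op_ep : {linear Lambda -> Lambda} := Lambda_restr Lambda_ep.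
Definition Lambda_op_h : {linear Lambda -> Lambda} := Lambda_restr Lambda_h.
Definition Lambda_op_em : {linear Lambda -> Lambda} := Lambda_restr Lambda_em.
Local Notation ep := Lambda_op_ep.
Local Notation h := Lambda_op_h.
Local Notation em := Lambda_op_em.

Fact Lambda_hep v : h (ep v) - ep (h v) = 2 *: ep v.
Proof. by apply: val_inj; rewrite /= pol_hep. Qed.
Fact Lambda_hem v : h (em v) - em (h v) = - 2 *: em v.
Proof. by apply: val_inj; rewrite /= pol_hem. Qed.
Fact Lambda_epem v : ep (em v) - em (ep v) = h v.
Proof. by apply: val_inj; rewrite /= pol_epem. Qed.

Definition sl2_Lambda := Sl2Module Lambda_hep Lambda_hem Lambda_epem.
End Lambda.

(* For m < n the truncated exponent makes one factor 1 - 'X^0 = 0, in agreement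
   with the factor k = n - m of the formula. *)
Definition gauss_num (m n : nat) : {poly int} :=
  \prod_(1 <= k < n.+1) (1 - 'X^(m + k - n)).
Definition gauss_den (n : nat) : {poly int} :=
  \prod_(1 <= k < n.+1) (1 - 'X^k).
(* The division is exact, see gauss_quotE. *)
Definition gauss_quot (m n : nat) : {poly int} := gauss_num m n %/ gauss_den n.

Lemma gauss_numS m n :
  gauss_num m.+1 n.+1 = gauss_num m n * (1 - 'X^(m.+1)).
Proof.
by rewrite /gauss_num [in LHS]big_nat_recr //= addnK; congr (_ * _).
Qed.

Lemma gauss_num_exact m n : exists q, gauss_num m n = q * gauss_den n.
Proof.
have num0 k : gauss_num k 0 = 1 by rewrite /gauss_num big_geq.
have den0 : gauss_den 0 = 1 by rewrite /gauss_den big_geq.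
have big k l : (k < l)%N -> gauss_num k l = 0.
  move=> lt_kl; rewrite /gauss_num (bigD1_seq (l - k)%N) ?iota_uniq //=.
    by rewrite subnKC 1?ltnW // subnn expr0 subrr mul0r.
  by rewrite mem_index_iota subn_gt0 lt_kl ltnS leq_subr.
elim: m n => [|m IHm] [|n]; rewrite ?num0 ?den0; try by exists 1; rewrite mulr1.
  by exists 0; rewrite big ?mul0r.
have [lt_mn | le_nm] := ltnP m n; first by exists 0; rewrite big ?mul0r.
have [[q1 Eq1] [q2 Eq2]] := (IHm n, IHm n.+1).
exists (q1 + 'X^(n.+1) * q2); rewrite mulrDl -mulrA -Eq2 gauss_numS.
have -> : gauss_num m n.+1 = (1 - 'X^(m - n)) * gauss_num m n.
  rewrite /gauss_num big_ltn // addn1 subSS; congr (_ * _).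
  rewrite big_add1 /=; apply: eq_bigr => k _.
  by rewrite addnS subSS.
rewrite /gauss_den big_nat_recr //= mulrA -Eq1.
have -> : 'X^(m.+1) = 'X^(n.+1) * 'X^(m - n) :> {poly int}.
  by rewrite -exprD addSn subnKC.
by ring.
Qed.

Lemma gauss_quotE m n : gauss_quot m n * gauss_den n = gauss_num m n.
Proof.
have [q Eq] := gauss_num_exact m n; rewrite /gauss_quot Eq.
rewrite Pdiv.IdomainUnit.mulpK // /gauss_den lead_coef_prod big_seq.
apply: rpred_prod => -[|k]; rewrite mem_index_iota // => _.
by rewrite -opprB lead_coefN lead_coefXnsubC // rpredN unitr1.
Qed.

(* gamma(m, n, j): the index j is rational, and the value is 0 by convention
   when j is negative or not an integer. *)
Definition gauss_coef (m n : nat) (j : rat) : int :=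
  if j \is a Num.nat then (gauss_quot m n)`_(Num.truncn j) else 0.

(* c_n(d, i) *)
Definition sl2_mult (n d i : nat) : int :=
    gauss_coef (d + n) n ((d * n)%:R / 2 - i%:R / 2)
  - gauss_coef (d + n) n ((d * n)%:R / 2 - i%:R / 2 - 1).

(* A partition inside the d x n rectangle is given by its n parts, all at most
   d, in weakly decreasing order and padded with zeros. *)
Definition box_partitions (d n j : nat) : {set n.-tuple 'I_d.+1} :=
  [set t : n.-tuple 'I_d.+1 |
     sorted (fun a b : 'I_d.+1 => (b <= a)%N) t
     && (\sum_(k < n) tnth t k == j)%N].

(* Main.v *)
(* On M = Lambda_n^(d) let W(a) be the h-eigenspace for a, and K(i) the kernel of
   e_- on W(-i). For u in K(i) the vectors (i (i-1) ... (i-t+1))^-1 e_+^t u span a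
   copy of V_i, since e_+^(i+1) u is again killed by e_- but has positive weight,
   which is impossible in finite dimension. The resulting map from the sum of the
   V_i, one copy for each vector of a basis of K(i), is injective: a kernel element
   killed by e_- is a combination of lowest weight vectors, which are independent.
   Complete reducibility then follows by counting: dim K(i) >= dim W(-i) - dim
   W(-i-2) by rank-nullity, while injectivity gives sum_i (i+1) dim K(i) <= dim M,
   and dim W(a) = dim W(-a) makes the two bounds meet. The monomial symmetric
   polynomials diagonalise h, so dim W(-i) counts partitions in the d x n box, and
   splitting these by their largest part gives the recursion of the Gaussian
   coefficients. *)
Require Import Defs.
From HB Require Import structures.
From mathcomp Require Import all_boot all_order all_fingroup all_algebra.
From mathcomp Require Import ring zify.

Set Implicit Arguments.
Unset Strict Implicit.
Unset Printing Implicit Defensive.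

Import Order.TTheory GRing.Theory Num.Theory.
Local Open Scope ring_scope.

(** * Gaussian coefficients count partitions in a rectangle *)

Lemma gauss_den_neq0 n : gauss_den n != 0.
Proof.
rewrite /gauss_den prodf_seq_neq0; apply/allP => -[|k]; rewrite mem_index_iota //.
by move=> _ /=; rewrite -opprB oppr_eq0 monic_neq0 // monicXnsubC.
Qed.

Lemma gauss_quot0 m : gauss_quot m 0 = 1.
Proof.
have := gauss_quotE m 0; rewrite /gauss_den /gauss_num !big_geq //.
by rewrite mulr1.
Qed.

Lemma gauss_quotnn n : gauss_quot n n = 1.
Proof.
apply: (mulIf (gauss_den_neq0 n)); rewrite gauss_quotE mul1r.
by apply: eq_bigr => k _; rewrite addKn.
Qed.

(** The q-Pascal rule. Once denominators are cleared it reduces to 1 - T^(d+n+2) = (1 - T^(d+1)) +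
    T^(d+1) (1 - T^(n+1)). *)
Lemma gauss_quotS d n :
  gauss_quot (d.+1 + n.+1) n.+1
    = gauss_quot (d + n.+1) n.+1 + 'X^(d.+1) * gauss_quot (d.+1 + n) n.
Proof.
apply: (mulIf (gauss_den_neq0 n.+1)); rewrite mulrDl !gauss_quotE addSnnS.
rewrite /gauss_den big_nat_recr //= -mulrA -/(gauss_den n).
rewrite [_ * (_ * (_ - _))]mulrA gauss_quotE [(d + _.+2)%N]addnS gauss_numS addSnnS.
have -> : gauss_num (d + n.+1) n.+1 = (1 - 'X^(d.+1)) * gauss_num (d + n.+1) n.
  rewrite /gauss_num big_ltn // addnAC addnK addn1; congr (_ * _).
  rewrite big_add1 /=; apply: eq_bigr => k _.
  by rewrite addnS subSS.
rewrite addnS.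
have -> : 'X^((d + n).+2) = 'X^(d.+1) * 'X^(n.+1) :> {poly int}.
  by rewrite -exprD addSn addnS.
by ring.
Qed.

(** Splits on the largest part: if it is below d, the bound d drops; if it equals d, it is removed
    and n drops. This mirrors [gauss_quotS]. The nested [fix] is there because each call decreases
    only one of the two arguments. *)
Fixpoint box_seqs (d : nat) : nat -> seq (seq nat) :=
  if d is d'.+1 then
    fix box_seqs_d (n : nat) : seq (seq nat) :=
      if n is n'.+1 then
        box_seqs d' n ++ [seq d :: s | s <- box_seqs_d n']
      else [:: [::]]
  else fun n => [:: nseq n 0%N].

Lemma mem_box_seqs d n s :
  (s \in box_seqs d n)
    = [&& size s == n, all (fun a => a <= d)%N s & sorted geq s].
Proof.
elim: d n s => [|d IHd] n s.
  rewrite /= inE; apply/eqP/and3P => [-> | [/eqP <- s0 _]].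
    rewrite size_nseq eqxx all_nseq orbT; split=> //.
    by elim: n => // -[|n] //= ->.
  by apply/all_pred1P; apply: sub_all s0 => a; rewrite leqn0.
elim: n s => [|n IHn] s; first by rewrite inE -size_eq0; case: s.
rewrite /= mem_cat IHd -/(box_seqs d.+1 n).
case: s => [|a s]; first by apply/mapP => -[].
have -> : (a :: s \in [seq d.+1 :: s0 | s0 <- box_seqs d.+1 n])
          = (a == d.+1) && (s \in box_seqs d.+1 n).
  apply/mapP/andP => [[s' s'P [-> ->]] | [/eqP-> sP]]; first by rewrite eqxx.
  by exists s.
rewrite IHn /= eqSS.
have geq_tr : transitive geq by move=> x y z /= xy yz; apply: leq_trans yz xy.
rewrite !(path_sortedE geq_tr).
have [-> | neq_a] /= := eqVneq a d.+1.
  rewrite ltnn /= andbF leqnn /=.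
  by case: all; rewrite ?andbF.
rewrite orbF [(a <= d.+1)%N]leq_eqVlt (negbTE neq_a) ltnS /=.
congr (_ && _); case le_ad: (a <= d)%N => //=.
(* The tail is bounded by its head a <= d, so the bounds d and d+1 on it are equivalent. *)
apply/andP/andP => -[_ sa]; split=> //; case/andP: sa => sa _;
  apply: sub_all sa => b /=; lia.
Qed.

Lemma box_seqs_uniq d n : uniq (box_seqs d n).
Proof.
elim: d n => // d IHd; elim=> // n IHn.
rewrite /= cat_uniq IHd -/(box_seqs d.+1 n) map_inj_uniq ?IHn; last by move=> s t [].
rewrite andbT; apply/hasPn => _ /mapP[s _ ->].
by rewrite mem_box_seqs /= ltnn andbF.
Qed.

Lemma coef_gauss_quot d n j :
  (gauss_quot (d + n) n)`_j = (count (fun s => sumn s == j) (box_seqs d n))%:Z.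
Proof.
elim: d n j => [|d IHd] n j.
  by rewrite gauss_quotnn coef1 /= sumn_nseq mul0n addn0 eq_sym; case: eqP.
elim: n j => [|n IHn] j; first by rewrite gauss_quot0 coef1 /= addn0 eq_sym; case: eqP.
rewrite gauss_quotS coefD IHd coefXnM /= -/(box_seqs d.+1 n) count_cat count_map.
(* Removing a leading part d+1 lowers the sum by d+1, which is the shift by ['X^(d.+1)]; for j < d+1
   there is no such sequence. *)
rewrite PoszD; congr (_ + _); have [lt_jd | le_dj] := ltnP j d.+1.
  by rewrite (eq_count (a2 := pred0)) ?count_pred0 // => s /=; lia.
by rewrite IHn; congr (Posz _); apply: eq_count => s /=; lia.
Qed.

Lemma card_box_partitions d n j :
  #|box_partitions d n j| = count (fun s => sumn s == j) (box_seqs d n).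
Proof.
pose f (t : n.-tuple 'I_d.+1) : seq nat := map val t.
have f_inj : injective f by move=> t u /(inj_map val_inj)/val_inj.
rewrite -size_filter cardE -(size_map f); apply/perm_size/uniq_perm.
- by rewrite map_inj_uniq ?enum_uniq.
- by rewrite filter_uniq ?box_seqs_uniq.
move=> s; rewrite mem_filter mem_box_seqs.
have sumf t : sumn (f t) = (\sum_(k < n) tnth t k)%N.
  by rewrite /f sumnE big_map big_tuple.
have sortedf t : sorted geq (f t) = sorted (fun a b : 'I_d.+1 => (b <= a)%N) t.
  by rewrite sorted_map.
apply/mapP/and4P => [[t] | [/eqP sj /eqP ss sd srt]].
  rewrite mem_enum inE => /andP[srt /eqP tj] ->.
  rewrite sumf tj eqxx size_map size_tuple eqxx sortedf srt; split=> //.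
  by rewrite all_map; apply/allP => a _ /=; rewrite -ltnS.
have szs : size (map (@inord d) s) == n by rewrite size_map ss.
have fE : f (Tuple szs) = s.
  rewrite /f /= -map_comp map_id_in // => a as_ /=.
  by rewrite inordK // ltnS (allP sd).
by exists (Tuple szs); rewrite ?fE // mem_enum inE -sortedf -sumf fE srt sj eqxx.
Qed.

Lemma gauss_coef_box d n j :
  gauss_coef (d + n) n j%:R = (#|box_partitions d n j|)%:Z.
Proof.
by rewrite /gauss_coef natr_nat natrK coef_gauss_quot card_box_partitions.
Qed.

(** * Homomorphisms from [sl2_V i] given by lowest weight vectors *)

Section WeightVectors.
Variables (V : lmodType rat) (ep h em : {linear V -> V}).
Hypothesis hep : forall v, h (ep v) - ep (h v) = 2 *: ep v.
Hypothesis epem : forall v, ep (em v) - em (ep v) = h v.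

Lemma h_iter_ep a z t :
  h z = a *: z -> h (iter t ep z) = (a + 2 * t%:R) *: iter t ep z.
Proof.
move=> hz; elim: t => [|t IHt] /=; first by rewrite mulr0 addr0.
have /eqP := hep (iter t ep z); rewrite subr_eq IHt => /eqP->.
by rewrite linearZ -scalerDl /= -natr1; congr (_ *: _); ring.
Qed.

(** Moving [em] past an [ep] costs -h, which acts on the s-th iterate by -(a + 2s); the sum of a +
    2s over s <= t is (t+1)(a+t). *)
Lemma em_iter_ep a z t : em z = 0 -> h z = a *: z ->
  em (iter t.+1 ep z) = - (t.+1%:R * (a + t%:R)) *: iter t ep z.
Proof.
move=> emz hz; have em_ep v : em (ep v) = ep (em v) - h v.
  by rewrite -epem opprB addrC subrK.
elim: t => [|t IHt]; first by rewrite /= em_ep emz linear0 hz sub0r -scaleNr addr0 mul1r.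
rewrite iterS em_ep IHt (h_iter_ep t.+1 hz) linearZ -scalerBl -!natr1 /=.
by congr (_ *: _); ring.
Qed.

Variable N : nat.
(** The form in which finite dimension enters: natural number weights are bounded by N. *)
Hypothesis wt_bound : forall a z, (N < a)%N -> h z = a%:R *: z -> z = 0.

Lemma lowest_pos_eq0 a z : (0 < a)%N -> em z = 0 -> h z = a%:R *: z -> z = 0.
Proof.
move=> a_gt0 emz hz.
have: iter N.+1 ep z = 0.
  apply: (@wt_bound (a + 2 * N.+1)); first lia.
  by rewrite (h_iter_ep _ hz) natrD natrM.
(* Descent from ep^(N+1) z = 0 to z = 0: each application of [em] gives a multiple of the previous
   iterate by -(t+1)(a+t), nonzero as a > 0. *)
elim: N.+1 => // t IHt ept0; apply: IHt; have := em_iter_ep t emz hz.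
rewrite ept0 linear0 => /esym/eqP; rewrite scaler_eq0 oppr_eq0 -natrD -natrM pnatr_eq0.
by rewrite muln_eq0 addn_eq0 (gtn_eqF a_gt0) => /eqP.
Qed.

(** The factor -(i+1)(-i+i) vanishes, so ep^(i+1) z is killed by [em] while its weight is i+2. *)
Lemma iter_ep_lowest i z : em z = 0 -> h z = - i%:R *: z -> iter i.+1 ep z = 0.
Proof.
move=> emz hz; apply: (@lowest_pos_eq0 i.+2) => //.
  by rewrite (em_iter_ep i emz hz) addNr mulr0 oppr0 scale0r.
rewrite (h_iter_ep _ hz) -!natr1; congr (_ *: _); ring.
Qed.

Variables (i : nat) (z : V).

(* For [t = i + 1] the scalar is [0^-1 = 0], in accordance with v_{i+1} = 0. *)
Definition std_img t := ((i ^_ t)%:R)^-1 *: iter t ep z.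

Definition std_hom (x : 'rV[rat]_i.+1) : V := \sum_t x 0 t *: std_img t.

Fact std_hom_is_linear : linear std_hom.
Proof.
move=> a x y; rewrite /std_hom scaler_sumr -big_split /=.
by apply: eq_bigr => t _; rewrite !mxE scalerDl [a *: _]scalerA.
Qed.
HB.instance Definition _ := GRing.isLinear.Build rat 'rV[rat]_i.+1 V *:%R
  std_hom std_hom_is_linear.

Lemma std_hom_v t : std_hom (std_v i t) = std_img t.
Proof.
have [lt_it | le_ti] := ltnP i t.
  by rewrite std_v_big // linear0 /std_img ffact_small // invr0 scale0r.
rewrite /std_hom (bigD1 (Ordinal (le_ti : t < i.+1)%N)) //= mxE eqxx scale1r.
rewrite big1 ?addr0 // => k; rewrite -val_eqE /= => /negbTE neq_kt.
by rewrite mxE neq_kt scale0r.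
Qed.

Lemma std_hom_ext (f g : {linear 'rV[rat]_i.+1 -> V}) :
  (forall t, (t <= i)%N -> f (std_v i t) = g (std_v i t)) -> f =1 g.
Proof.
move=> fg v; rewrite (row_sum_delta v) !linear_sum; apply: eq_bigr => k _.
rewrite !linearZ; congr (_ *: _); have := fg k (ltn_ord k).
suff -> : std_v i k = delta_mx 0 k by [].
by apply/rowP => l; rewrite !mxE eqxx -val_eqE.
Qed.

Hypotheses (emz : em z = 0) (hz : h z = - i%:R *: z).

Lemma std_hom_ep x : std_hom (std_ep i x) = ep (std_hom x).
Proof.
move: x; apply: (@std_hom_ext (std_hom \o std_ep i) (ep \o std_hom)) => t.
rewrite /= -[_ *m _]/(std_ep i (std_v i t)) std_ep_v linearZ /= !std_hom_v.
rewrite /std_img [ep _]linearZ scalerA /= leq_eqVlt => /predU1P[-> | lt_ti].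
  by rewrite subrr mul0r scale0r -iterS iter_ep_lowest // scaler0.
(* Consecutive falling factorials differ by the factor i - t, which cancels the coefficient of
   [std_ep_v]. *)
congr (_ *: _); rewrite ffactnSr natrM natrB 1?ltnW // invfM mulrCA mulfV ?mulr1 //.
by rewrite subr_eq0 eqr_nat gtn_eqF.
Qed.

Lemma std_hom_h x : std_hom (std_h i x) = h (std_hom x).
Proof.
move: x; apply: (@std_hom_ext (std_hom \o std_h i) (h \o std_hom)) => t _.
rewrite /= -[_ *m _]/(std_h i (std_v i t)) std_h_v linearZ /= !std_hom_v.
rewrite /std_img [h _]linearZ /= (h_iter_ep _ hz) !scalerA.
by congr (_ *: _); ring.
Qed.

Lemma std_hom_em x : std_hom (std_em i x) = em (std_hom x).
Proof.
move: x; apply: (@std_hom_ext (std_hom \o std_em i) (em \o std_hom)) => t le_ti.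
rewrite /= -[_ *m _]/(std_em i (std_v i t)) std_em_v // linearZ /= !std_hom_v.
rewrite /std_img [em _]linearZ; case: t le_ti => [|t] lt_ti.
  by rewrite scale0r /= emz scaler0.
rewrite (em_iter_ep _ emz hz) /= !scalerA; congr (_ *: _).
(* The scalar -(t+1)(-i+t) contains the factor i - t of [i ^_ t.+1]; what remains is (t+1) /
   [i ^_ t]. *)
rewrite ffactnSr natrM natrB 1?ltnW // invfM.
have -> : - i%:R + t%:R = - (i%:R - t%:R) :> rat by rewrite opprB addrC.
rewrite !mulrN opprK.
rewrite mulrACA mulVf ?mulr1 1?mulrC // subr_eq0 eqr_nat gtn_eqF //.
Qed.

End WeightVectors.

(** Applying m + h to a vanishing sum of y 0, ..., y m kills y m and multiplies each other y i by m
    - i, which is nonzero; induction then applies to the vectors (m - i) y i. *)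
Lemma eigenvector_sum_eq0 (V : lmodType rat) (h : {linear V -> V}) m (y : nat -> V) :
    (forall i, h (y i) = - i%:R *: y i) ->
  \sum_(i < m) y i = 0 -> forall i, (i < m)%N -> y i = 0.
Proof.
elim: m y => // m IHm y hy; rewrite big_ord_recr /= => sum0.
have y0 i : (i < m)%N -> y i = 0.
  move=> lt_im; have: (m%:R - i%:R) *: y i = 0.
    apply: (IHm (fun i => (m%:R - i%:R) *: y i)) => // [k|].
      by rewrite linearZ /= hy !scalerA mulrC.
    have := congr1 h sum0; rewrite linear0 linearD linear_sum /= hy.
    have := congr1 (fun v => m%:R *: v) sum0; rewrite /= scaler0 scalerDr.
    move=> E1 E2; have := congr2 +%R E1 E2; rewrite addr0.
    rewrite addrACA scaleNr subrr addr0 scaler_sumr -big_split /=.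
    by apply: etrans; apply: eq_bigr => k _; rewrite hy scalerBl scaleNr.
  by move/eqP; rewrite scaler_eq0 subr_eq0 eqr_nat gtn_eqF // => /eqP.
move=> i; rewrite ltnS leq_eqVlt => /predU1P[-> | /y0//].
by move: sum0; rewrite big1 ?add0r // => k _; apply: y0.
Qed.

(** In coordinates [std_em] is the derivative of the polynomial with coefficients x, so its kernel
    is spanned by v_0. *)
Lemma std_em_coord i (x : 'rV[rat]_i.+1) (k : 'I_i.+1) :
  std_em i x 0 k = if (k < i)%N then k.+1%:R * x 0 (inord k.+1) else 0.
Proof.
rewrite /= mxE; case: ltnP => [lt_ki | le_ik].
  rewrite (bigD1 (inord k.+1)) //= big1 ?addr0 => [|j neq_j].
    by rewrite !mxE !inordK ?eqxx ?mulr1 1?mulrC ?ltnS.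
  rewrite !mxE; case: j neq_j => -[|j] lt_j neq_j /=; first by rewrite mul0r mulr0.
  suff /negbTE-> : (k != j :> nat)%N by rewrite !mulr0.
  by apply: contraNneq neq_j => kj; apply/eqP/val_inj; rewrite /= inordK ?kj.
rewrite big1 // => j _; rewrite !mxE; case: j => -[|j] lt_j /=.
  by rewrite mul0r mulr0.
suff /negbTE-> : (k != j :> nat)%N by rewrite !mulr0.
by rewrite gtn_eqF // (leq_trans _ le_ik).
Qed.

(** * The map from a direct sum of modules [sl2_V i] and its injectivity *)

Section Decomposition.
Variables (V : vectType rat) (ep h em : {linear V -> V}).
Hypothesis hep : forall v, h (ep v) - ep (h v) = 2 *: ep v.
Hypothesis hem : forall v, h (em v) - em (h v) = - 2 *: em v.
Hypothesis epem : forall v, ep (em v) - em (ep v) = h v.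

Variable N : nat.
Hypothesis wt_bound : forall a z, (N < a)%N -> h z = a%:R *: z -> z = 0.

Section SumHom.
Variables (c : nat -> nat) (u : nat -> nat -> V).
Hypothesis emu : forall i s, em (u i s) = 0.
Hypothesis hu : forall i s, h (u i s) = - i%:R *: u i s.

Local Notation D :=
  (sl2_dsum (fun i : 'I_N.+1 => sl2_copies (c i) (sl2_V i))).

Definition dcoord (x : D) (i : 'I_N.+1) (s : 'I_(c i)) : 'rV[rat]_i.+1 :=
  dsum_coord (dsum_coord x i) s.
Arguments dcoord : clear implicits.

Lemma dcoord_linear a x y (i : 'I_N.+1) (s : 'I_(c i)) :
  dcoord (a *: x + y) i s = a *: dcoord x i s + dcoord y i s.
Proof. by rewrite /dcoord /= !dsum_coordD !dsum_coordZ. Qed.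

Lemma dcoordP (x y : D) :
  (forall (i : 'I_N.+1) (s : 'I_(c i)), dcoord x i s = dcoord y i s) -> x = y.
Proof. by move=> xy; apply: dsumP => i; apply: dsumP => s; apply: xy. Qed.

Lemma dcoord_ep (x : D) (i : 'I_N.+1) (s : 'I_(c i)) :
  dcoord (sl2_ep x) i s = std_ep i (dcoord x i s).
Proof. by rewrite /dcoord /= !dsumE. Qed.
Lemma dcoord_h (x : D) (i : 'I_N.+1) (s : 'I_(c i)) :
  dcoord (sl2_h x) i s = std_h i (dcoord x i s).
Proof. by rewrite /dcoord /= !dsumE. Qed.
Lemma dcoord_em (x : D) (i : 'I_N.+1) (s : 'I_(c i)) :
  dcoord (sl2_em x) i s = std_em i (dcoord x i s).
Proof. by rewrite /dcoord /= !dsumE. Qed.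

Definition sum_hom (x : D) : V :=
  \sum_(i < N.+1) \sum_(s < c i) std_hom ep (u i s) (dcoord x i s).

Fact sum_hom_is_linear : linear sum_hom.
Proof.
move=> a x y; rewrite /sum_hom scaler_sumr -big_split /=; apply: eq_bigr => i _.
rewrite scaler_sumr -big_split /=; apply: eq_bigr => s _.
by rewrite dcoord_linear linearP.
Qed.
HB.instance Definition _ := GRing.isLinear.Build rat D V *:%R
  sum_hom sum_hom_is_linear.

Lemma sum_hom_ep x : sum_hom (sl2_ep x) = ep (sum_hom x).
Proof.
rewrite /sum_hom linear_sum; apply: eq_bigr => i _.
rewrite linear_sum; apply: eq_bigr => s _.
by rewrite dcoord_ep (std_hom_ep hep epem wt_bound).
Qed.
Lemma sum_hom_h x : sum_hom (sl2_h x) = h (sum_hom x).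
Proof.
rewrite /sum_hom linear_sum; apply: eq_bigr => i _.
rewrite linear_sum; apply: eq_bigr => s _.
by rewrite dcoord_h (std_hom_h hep).
Qed.
Lemma sum_hom_em x : sum_hom (sl2_em x) = em (sum_hom x).
Proof.
rewrite /sum_hom linear_sum; apply: eq_bigr => i _.
rewrite linear_sum; apply: eq_bigr => s _.
by rewrite dcoord_em (std_hom_em hep epem).
Qed.

Hypothesis u_free : forall i (x : nat -> rat), (i <= N)%N ->
  \sum_(s < c i) x s *: u i s = 0 -> forall s, (s < c i)%N -> x s = 0.

Lemma sum_hom_inj : injective sum_hom.
Proof.
(* Induction on a bound t for the nonzero coordinates; [em] lowers this bound by one and preserves
   the kernel. *)
have phi_inj t x : (forall (i : 'I_N.+1) (s : 'I_(c i)) (k : 'I_i.+1),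
    (t <= k)%N -> dcoord x i s 0 k = 0) -> sum_hom x = 0 -> x = 0.
  elim: t x => [|t IHt] x xt phix.
    by apply: dcoordP => i s; apply/rowP => k; rewrite xt // /dcoord !dsumE mxE.
  have emx : sl2_em x = 0.
    apply: IHt; last by rewrite sum_hom_em phix linear0.
    move=> i s k le_tk; rewrite dcoord_em std_em_coord.
    by case: ltnP => // lt_ki; rewrite xt ?mulr0 // inordK ?ltnS.
  have x_gt0 (i : 'I_N.+1) (s : 'I_(c i)) (k : 'I_i.+1) :
      (0 < k)%N -> dcoord x i s 0 k = 0.
    case: k => -[|k] lt_k //= _; have := dcoord_em x s.
    rewrite emx => /rowP/(_ (inord k)); rewrite std_em_coord /dcoord !dsumE mxE.
    rewrite (inordK (ltnW lt_k)) -ltnS lt_k => /esym/eqP.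
    rewrite mulf_eq0 pnatr_eq0 /= => /eqP <-; congr (_ _ _).
    by apply: val_inj; rewrite /= inordK.
  (* As only the v_0 coordinates of x survive, [sum_hom x] is the sum of these weight -i components.
     The value 0 beyond N makes y a function on [nat], as [eigenvector_sum_eq0] expects. *)
  pose y (i : nat) : V := oapp (fun i' : 'I_N.+1 =>
    \sum_(s < c i') dcoord x i' s 0 0 *: u i' s) 0 (insub i).
  have yE (i : 'I_N.+1) : y i = \sum_(s < c i) dcoord x i s 0 0 *: u i s.
    by rewrite /y valK.
  have hy i : h (y i) = - i%:R *: y i.
    rewrite /y; case: insubP => [i' _ <-|_]; last by rewrite linear0 scaler0.
    rewrite linear_sum scaler_sumr; apply: eq_bigr => s _ /=.
    by rewrite linearZ /= hu !scalerA mulrC.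
  have y0 := eigenvector_sum_eq0 hy (m := N.+1).
  apply: dcoordP => i s; apply/rowP => k; rewrite [RHS](_ : _ = 0); last first.
    by rewrite /dcoord !dsumE mxE.
  have [k0 | /x_gt0//] := posnP k; have -> : k = 0 by apply: val_inj.
  pose xs r := oapp (fun s' : 'I_(c i) => dcoord x i s' 0 0) 0 (insub r).
  have xsE (s' : 'I_(c i)) : xs s' = dcoord x i s' 0 0 by rewrite /xs valK.
  rewrite -xsE; apply: u_free (ltn_ord i) _ _ (ltn_ord s).
  transitivity (y i); first by rewrite yE; apply: eq_bigr => s' _; rewrite xsE.
  apply: y0 => //; rewrite -[RHS]phix; apply: eq_bigr => j _; rewrite yE.
  apply: eq_bigr => s' _; rewrite /std_hom big_ord_recl /std_img ffactn0 invr1 scale1r.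
  by rewrite big1 ?addr0 // => l _; rewrite x_gt0 ?scale0r.
(* The bound N+1 imposes no condition, because k <= i <= N. *)
apply: raddf_inj => x; apply: (phi_inj N.+1) => i s k.
by rewrite ltnNge -ltnS (leq_trans (ltn_ord k)).
Qed.

(** Labels (i, s, k) of the basis vectors v_k in the s-th copy of [sl2_V i]. Functions on this set
    form a space of known dimension that replaces the direct sum in the dimension arguments. *)
Definition sum_index : finType := {i : 'I_N.+1 & ('I_(c i) * 'I_i.+1)%type}.

Definition sum_of_ffun (x : {ffun sum_index -> rat^o}) : D :=
  dsum_mk (fun i : 'I_N.+1 => dsum_mk (M := fun=> sl2_V i) (fun s : 'I_(c i) =>
    (\row_(k < i.+1) x (Tagged _ (s, k))) : sl2_V i)).

Lemma dcoord_of_ffun x (i : 'I_N.+1) (s : 'I_(c i)) (k : 'I_i.+1) :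
  dcoord (sum_of_ffun x) i s 0 k = x (Tagged _ (s, k)).
Proof. by rewrite /dcoord !dsumE mxE. Qed.

Fact sum_of_ffun_is_linear : linear sum_of_ffun.
Proof.
move=> a x y; apply: dcoordP => i s; apply/rowP => k.
by rewrite dcoord_linear !mxE !dcoord_of_ffun !ffunE.
Qed.
HB.instance Definition _ := GRing.isLinear.Build rat {ffun sum_index -> rat^o} D *:%R
  sum_of_ffun sum_of_ffun_is_linear.

Lemma sum_of_ffun_inj : injective sum_of_ffun.
Proof.
by move=> x y xy; apply/ffunP => -[i [s k]]; rewrite -!dcoord_of_ffun xy.
Qed.

Lemma card_sum_index : #|sum_index| = (\sum_(i < N.+1) c i * i.+1)%N.
Proof.
rewrite card_tagged sumnE big_map big_enum /=; apply: eq_bigr => i _.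
by rewrite card_prod !card_ord.
Qed.

Let flat_hom := linfun (sum_hom \o sum_of_ffun).

Let flat_hom_ker : lker flat_hom == 0%VS.
Proof.
by apply/lker0P => x y; rewrite !lfunE /= => /sum_hom_inj/sum_of_ffun_inj.
Qed.

Let dim_flat_hom : \dim (limg flat_hom) = (\sum_(i < N.+1) c i * i.+1)%N.
Proof.
rewrite limg_dim_eq ?(eqP flat_hom_ker) ?capv0 // dimvf -card_sum_index.
(* The functions into [rat^o] have dimension #|sum_index| * 1. *)
exact: muln1.
Qed.

Lemma leq_dim_sum : (\sum_(i < N.+1) c i * i.+1 <= \dim {:V})%N.
Proof. by rewrite -dim_flat_hom dimvS ?subvf. Qed.

Lemma sum_hom_surj : (\sum_(i < N.+1) c i * i.+1)%N = \dim {:V} ->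
  forall v, exists x, v = sum_hom x.
Proof.
rewrite -dim_flat_hom => dimE v.
have /eqP img : limg flat_hom == fullv by rewrite eqEdim subvf dimE leqnn.
have : v \in limg flat_hom by rewrite img memvf.
by case/memv_imgP => x _ ->; exists (sum_of_ffun x); rewrite lfunE.
Qed.

End SumHom.

(** * Weight spaces, indexed by minus the weight, and the dimension count *)

Definition wt_space i : {vspace V} := lker (linfun h + i%:R *: \1)%VF.
Definition lowest_space i : {vspace V} := (wt_space i :&: lker (linfun em))%VS.

Lemma mem_wt_space i v : (v \in wt_space i) = (h v == - i%:R *: v).
Proof. by rewrite memv_ker add_lfunE scale_lfunE id_lfunE lfunE scaleNr addr_eq0. Qed.

Lemma mem_lowest_space i v :
  (v \in lowest_space i) = (h v == - i%:R *: v) && (em v == 0).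
Proof. by rewrite memv_cap mem_wt_space memv_ker lfunE. Qed.

(** Rank-nullity for [em], which maps [wt_space i] into [wt_space i.+2]. *)
Lemma dim_wt_space_le i :
  (\dim (wt_space i) <= \dim (lowest_space i) + \dim (wt_space i.+2))%N.
Proof.
rewrite -(limg_ker_dim (linfun em) (wt_space i)) leq_add2l.
apply/dimvS/subvP => _ /memv_imgP[v + ->]; rewrite lfunE !mem_wt_space => /eqP hv.
have /eqP := hem v; rewrite subr_eq hv => /eqP ->.
by rewrite linearZ -scalerDl -!natr1 /=; apply/eqP; congr (_ *: _); ring.
Qed.

Hypothesis wt_bound_neg : forall a z, (N < a)%N -> h z = - a%:R *: z -> z = 0.
(** This combines two facts: the integer weights from -N to N account for all of V, and opposite
    weights have equal multiplicity, whence the factor 2. *)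
Hypothesis dimV : \dim {:V} =
  (\dim (wt_space 0) + 2 * \sum_(i < N) \dim (wt_space i.+1))%N.

Let c i := \dim (lowest_space i).
Let u i s := (vbasis (lowest_space i))`_s.

Let u_lowest i s : h (u i s) = - i%:R *: u i s /\ em (u i s) = 0.
Proof.
have /= : u i s \in lowest_space i.
  rewrite /u; have [lt_s|le_s] := ltnP s (size (vbasis (lowest_space i))).
    by rewrite vbasis_mem ?mem_nth.
  (* Beyond the basis the default value 0 still satisfies both equations. *)
  by rewrite nth_default ?mem0v.
by rewrite mem_lowest_space => /andP[/eqP -> /eqP ->].
Qed.

Let hu i s := (u_lowest i s).1.
Let emu i s := (u_lowest i s).2.

Let u_free i (x : nat -> rat) : (i <= N)%N ->
  \sum_(s < c i) x s *: u i s = 0 -> forall s, (s < c i)%N -> x s = 0.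
Proof.
move=> _ sum0 s lt_s; have /freeP := basis_free (vbasisP (lowest_space i)).
by move=> /(_ (fun s => x s) sum0 (Ordinal lt_s)).
Qed.

Lemma wt_space_big i : (N < i)%N -> \dim (wt_space i) = 0%N.
Proof.
move=> lt_Ni; apply/eqP; rewrite dimv_eq0 -subv0; apply/subvP => v.
by rewrite mem_wt_space memv0 => /eqP/(wt_bound_neg lt_Ni) ->.
Qed.

(** Summing the bounds [dim_wt_space_le] with weights i+1 gives dim V <= sum of c i * (i+1), and
    [leq_dim_sum] is the reverse inequality. Hence each of the bounds is an equality. *)
Lemma dim_lowest_space_eq :
  (\sum_(i < N.+1) c i * i.+1)%N = \dim {:V} /\
  forall i, (i <= N)%N -> (c i + \dim (wt_space i.+2) = \dim (wt_space i))%N.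
Proof.
pose w i := \dim (wt_space i).
have w0 i : (N < i)%N -> w i = 0%N by apply: wt_space_big.
(* Summation by parts: for i >= 2 the coefficients of w i differ by (i+1) - (i-1) = 2. The two
   boundary terms on the left vanish at m = N. *)
have key m : (\sum_(i < m.+1) w i * i.+1 + w m.+1 * m + w m.+2 * m.+1 =
    w 0 + 2 * (\sum_(i < m) w i.+1) + \sum_(i < m.+1) w i.+2 * i.+1)%N.
  elim: m => [|m IHm]; first by rewrite !big_ord_recr !big_ord0 /=; lia.
  by move: IHm; rewrite !big_ord_recr /=; lia.
have w_key : (\sum_(i < N.+1) w i * i.+1 =
    \dim {:V} + \sum_(i < N.+1) w i.+2 * i.+1)%N.
  by rewrite dimV -/(w 0%N) -key !w0 // !addn0.
have ge i : true -> (w i * i.+1 <= (c i + w i.+2) * i.+1)%N.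
  by rewrite leq_mul2r dim_wt_space_le orbT.
have le : (\sum_(i < N.+1) (c i + w i.+2) * i.+1 <= \sum_(i < N.+1) w i * i.+1)%N.
  under eq_bigr do rewrite mulnDl.
  by rewrite big_split w_key leq_add2r (leq_dim_sum emu hu u_free).
have [geS eqS] := @leqif_sum 'I_N.+1 predT _ _ _ (fun i _ => leqif_eq (ge i isT)).
have eq_sum : (\sum_(i < N.+1) w i * i.+1 == \sum_(i < N.+1) (c i + w i.+2) * i.+1)%N.
  by rewrite eqn_leq geS le.
split.
  apply/eqP; rewrite -(eqn_add2r (\sum_(i < N.+1) w i.+2 * i.+1)) -w_key.
  by rewrite (eqP eq_sum) -big_split; apply/eqP/eq_bigr => i _; rewrite mulnDl.
move: eq_sum; rewrite eqS => /forallP eqw i le_iN.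
have /implyP/(_ isT) := eqw (Ordinal (le_iN : i < N.+1)%N).
by rewrite eqn_mul2r => /= /eqP.
Qed.

(** The multiplicity function m is left free because the type of the target depends on it; the
    hypothesis forces it to agree with [c] up to N. *)
Theorem sl2_decomposition (m : nat -> nat) :
    (forall i, (i <= N)%N -> (m i + \dim (wt_space i.+2) = \dim (wt_space i))%N) ->
  sl2_iso (Sl2Module hep hem epem)
    (sl2_dsum (fun i : 'I_N.+1 => sl2_copies (m i) (sl2_V i))).
Proof.
move=> mE; have [dim_sum cE] := dim_lowest_space_eq.
have mc i : (i <= N)%N -> m i = c i.
  by move=> le_iN; apply/eqP; rewrite -(eqn_add2r (\dim (wt_space i.+2))) mE ?cE.
have u_free' i (x : nat -> rat) : (i <= N)%N ->
    \sum_(s < m i) x s *: u i s = 0 -> forall s, (s < m i)%N -> x s = 0.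
  by move=> le_iN; rewrite mc //; apply: u_free.
have dim_sum_m : (\sum_(i < N.+1) m i * i.+1)%N = \dim {:V}.
  by rewrite -dim_sum; apply: eq_bigr => i _; rewrite mc // -ltnS.
pose D := sl2_dsum (fun i : 'I_N.+1 => sl2_copies (m i) (sl2_V i)).
pose phi : {linear D -> V} := @sum_hom m u.
have phi_inj : injective phi := sum_hom_inj emu hu u_free'.
have phi_surj v : exists x, v == phi x.
  by have [x ->] := sum_hom_surj emu hu u_free' dim_sum_m v; exists x.
(* The isomorphism must start from V, so it is the inverse of phi, chosen pointwise; injectivity of
   phi makes it linear and equivariant. *)
pose psi v : D := xchoose (phi_surj v).
have phiK v : phi (psi v) = v by apply/esym/eqP/(xchooseP (phi_surj v)).
have psiK x : psi (phi x) = x by apply: phi_inj; rewrite phiK.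
have psi_linear : linear psi.
  by move=> a v w; apply: phi_inj; rewrite linearP !phiK.
pose psiL := GRing.isLinear.Build rat V D *:%R psi psi_linear.
pose psi' : {linear V -> D} := HB.pack psi psiL.
exists psi'; split.
- by exists phi => v; [apply: phiK | apply: psiK].
- by move=> v; apply: phi_inj; rewrite /= sum_hom_ep // -/phi !phiK.
- by move=> v; apply: phi_inj; rewrite /= sum_hom_h // -/phi !phiK.
- by move=> v; apply: phi_inj; rewrite /= sum_hom_em // -/phi !phiK.
Qed.
End Decomposition.

(** * Dimension of coordinate subspaces *)

Section CoordSubspace.
Variables (V : vectType rat) (m : nat) (f : {linear V -> 'rV[rat]_m}).
Hypothesis f_bij : bijective f.

(** Extending functions on S by zero and applying the inverse of f gives an injective map with image
    U. *)
Lemma dim_coord_subspace (S : {set 'I_m}) (U : {vspace V}) :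
    (forall v, v \in U <-> forall k, k \notin S -> f v 0 k = 0) ->
  \dim U = #|S|.
Proof.
move=> memU; have [g fK gK] := f_bij; pose T := {k : 'I_m | k \in S}.
pose ext (x : {ffun T -> rat^o}) : V := g (\row_k oapp x 0 (insub k : option T)).
have ext_linear : linear ext.
  move=> a x y; apply: (can_inj fK); rewrite linearP !gK; apply/rowP => k.
  by rewrite !mxE; case: insub => [k'|] /=; rewrite ?ffunE // mulr0 addr0.
pose extL := GRing.isLinear.Build rat _ V *:%R ext ext_linear.
pose ext' : {linear {ffun T -> rat^o} -> V} := HB.pack ext extL.
have ext_ker : lker (linfun ext') == 0%VS.
  apply/lker0P => x y; rewrite !lfunE /= => /(can_inj gK)/rowP xy.
  by apply/ffunP => k; have := xy (val k); rewrite !mxE valK.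
have -> : U = limg (linfun ext').
  apply/vspaceP => v; apply/idP/memv_imgP => [/memU vS | [x _ ->]].
    exists [ffun k => f v 0 (val k)]; rewrite ?memvf // lfunE /= /ext.
    apply: (can_inj fK); rewrite gK; apply/rowP => k; rewrite mxE.
    by case: insubP => [k' _ <-|/vS] //=; rewrite ffunE.
  by rewrite lfunE /= /ext; apply/memU => k kS; rewrite gK mxE insubN.
rewrite limg_dim_eq ?(eqP ext_ker) ?capv0 // dimvf -(card_sig (mem S)).
exact: muln1.
Qed.
End CoordSubspace.

(** * Coordinates on [Lambda n d] by monomial symmetric polynomials *)

Section LambdaBasis.
Variables n d : nat.
Local Notation box := (n.-tuple 'I_d.+1).
Implicit Types (t u : box) (m : 'X_{1..n}).

Definition geq_ord (a b : 'I_d.+1) := (b <= a)%N.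
Definition tsum t : nat := (\sum_(k < n) tnth t k)%N.
(** The partitions inside the rectangle, which label the monomial symmetric polynomials. *)
Definition box_all : {set box} := [set t : box | sorted geq_ord t].
Definition box_mnm t : 'X_{1..n} := [multinom (tnth t k : nat) | k < n].
Definition mnm_box m : box := [tuple inord (m k) | k < n].
Definition box_sort t : box := [tuple of sort geq_ord t].

Lemma geq_ord_total : total geq_ord.
Proof. by move=> a b; apply: leq_total. Qed.
Lemma geq_ord_trans : transitive geq_ord.
Proof. by move=> a b c ba cb; apply: leq_trans cb ba. Qed.
Lemma geq_ord_anti : antisymmetric geq_ord.
Proof. by move=> a b; rewrite /geq_ord andbC -eqn_leq => /eqP/val_inj. Qed.

Lemma box_sort_in t : box_sort t \in box_all.
Proof. by rewrite inE sort_sorted //; apply: geq_ord_total. Qed.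

Lemma box_sort_id t : t \in box_all -> box_sort t = t.
Proof.
by rewrite inE => srt; apply: val_inj; rewrite /= sorted_sort //; apply: geq_ord_trans.
Qed.

Lemma box_sort_perm t u : perm_eq t u -> box_sort t = box_sort u.
Proof.
move=> tu; apply: val_inj; apply/(perm_sortP geq_ord_total geq_ord_trans geq_ord_anti).
exact: tu.
Qed.

Lemma box_mnmK t : mnm_box (box_mnm t) = t.
Proof. by apply: eq_from_tnth => k; rewrite tnth_mktuple mnmE inord_val. Qed.

Lemma mnm_boxK m : [forall k, m k <= d]%N -> box_mnm (mnm_box m) = m.
Proof.
by move=> /forallP md; apply/mnmP => k; rewrite mnmE tnth_mktuple inordK ?ltnS.
Qed.

Lemma box_mnm_le t : [forall k, box_mnm t k <= d]%N.
Proof. by apply/forallP => k; rewrite mnmE -ltnS. Qed.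

Lemma mdeg_box_mnm t : mdeg (box_mnm t) = tsum t.
Proof. by rewrite mdegE; apply: eq_bigr => k _; rewrite mnmE. Qed.

Lemma Lambda_coef_perm (p : Lambda n d) t u :
  perm_eq t u -> p@_(box_mnm t) = p@_(box_mnm u).
Proof.
case/tuple_permP => s Et; have /andP[ps _] := Lambda_valP p.
rewrite -(msym_coeff (box_mnm u) s ps); congr (_@__).
apply/mnmP => k; rewrite !mnmE; congr (nat_of_ord _).
by rewrite (val_inj Et : t = _) tnth_mktuple.
Qed.

Definition Lambda_coord (p : Lambda n d) : 'rV[rat]_#|box_all| :=
  \row_k p@_(box_mnm (enum_val k)).

Definition box_rank t : 'I_#|box_all| := enum_rank_in (box_sort_in t) (box_sort t).

(** A combination of monomial symmetric polynomials, written as one sum over all exponent vectors;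
    each takes the coefficient belonging to its sorted rearrangement. *)
Definition coord_poly (r : 'rV[rat]_#|box_all|) : {mpoly rat[n]} :=
  \sum_(t : box) r 0 (box_rank t) *: 'X_[box_mnm t].

Lemma mcoeff_coord_poly r m : (coord_poly r)@_m =
  if [forall k, m k <= d]%N then r 0 (box_rank (mnm_box m)) else 0.
Proof.
rewrite /coord_poly raddf_sum /=; case: ifPn => [md | /negP md].
  rewrite (bigD1 (mnm_box m)) //= big1 => [|t neq_t].
    by rewrite mcoeffZ mcoeffX mnm_boxK // eqxx mulr1 addr0.
  rewrite mcoeffZ mcoeffX; case: eqP => [Em|]; last by rewrite mulr0.
  by rewrite -Em box_mnmK eqxx in neq_t.
rewrite big1 // => t _; rewrite mcoeffZ mcoeffX; case: eqP => [Em|]; last by rewrite mulr0.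
by case: md; rewrite -Em box_mnm_le.
Qed.

Lemma box_rank_perm t u : perm_eq t u -> box_rank t = box_rank u.
Proof.
move=> /box_sort_perm tu; apply: enum_val_inj.
by rewrite /box_rank !enum_rankK_in ?box_sort_in.
Qed.

Lemma coord_poly_Lambda r : coord_poly r \in Lambda_pred d.
Proof.
apply/andP; split.
  apply/issymP => s; apply/mpolyP => m; rewrite mcoeff_sym !mcoeff_coord_poly.
  have -> : [forall k, [multinom m (s i) | i < n] k <= d]%N = [forall k, m k <= d]%N.
    apply/forallP/forallP => md k; last by rewrite mnmE.
    by have := md ((s^-1)%g k); rewrite mnmE permKV.
  case: ifP => // _; congr (r 0 _); apply: box_rank_perm.
  apply/tuple_permP; exists s; congr val; apply: eq_from_tnth => k.
  by rewrite !tnth_mktuple mnmE.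
apply/deg_leP => m; rewrite mcoeff_msupp mcoeff_coord_poly.
by case: ifP => [/forallP // | _]; rewrite eqxx.
Qed.

Definition coord_Lambda r : Lambda n d := MkLambda (coord_poly_Lambda r).

Fact Lambda_coord_is_linear : linear Lambda_coord.
Proof. by move=> a p q; apply/rowP => k; rewrite !mxE mcoeffD mcoeffZ. Qed.
HB.instance Definition _ := GRing.isLinear.Build rat (Lambda n d) 'rV[rat]_#|box_all|
  *:%R Lambda_coord Lambda_coord_is_linear.

Lemma Lambda_coordK : cancel Lambda_coord coord_Lambda.
Proof.
move=> p; apply: val_inj; apply/mpolyP => m; rewrite /= mcoeff_coord_poly.
case: ifPn => [md | /forallP md].
  rewrite mxE enum_rankK_in ?box_sort_in //.
  rewrite -[in RHS](mnm_boxK md); apply: Lambda_coef_perm.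
  by rewrite perm_sort.
apply/esym; rewrite memN_msupp_eq0 //; apply/negP => mp; apply: md.
by have /andP[_ /deg_leP] := Lambda_valP p; apply.
Qed.

Lemma coord_LambdaK : cancel coord_Lambda Lambda_coord.
Proof.
move=> r; apply/rowP => k; rewrite mxE /= mcoeff_coord_poly box_mnm_le box_mnmK.
congr (r 0 _); apply: enum_val_inj.
by rewrite enum_rankK_in ?box_sort_in ?box_sort_id ?enum_valP.
Qed.

Lemma Lambda_coord_bij : bijective Lambda_coord.
Proof. by exists coord_Lambda; [apply: Lambda_coordK | apply: coord_LambdaK]. Qed.

Fact Lambda_vect_axiom : Vector.axiom #|box_all| (Lambda n d).
Proof. by exists Lambda_coord; [apply: Lambda_coord_is_linear | apply: Lambda_coord_bij]. Qed.
HB.instance Definition _ := Lmodule_hasFinDim.Build rat (Lambda n d) Lambda_vect_axiom.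

Lemma mcoeff_pol_h (p : {mpoly rat[n]}) m :
  (pol_h d p)@_m = (2 * (mdeg m)%:R - (n * d)%:R) * p@_m.
Proof.
pose c m' : rat := 2 * (mdeg m')%:R - (n * d)%:R.
rewrite -/(c m) [in LHS](mpolyE p) [in RHS](mpolyE p) linear_sum !raddf_sum mulr_sumr.
apply: eq_bigr => m' _; rewrite linearZ /= pol_hX -/(c m') !mcoeffZ mcoeffX.
by case: eqP => [->|_]; rewrite ?mulr0 // !mulr1 mulrC.
Qed.

Lemma Lambda_coord_h (p : Lambda n d) k :
  Lambda_coord (Lambda_op_h n d p) 0 k =
  (2 * (tsum (enum_val k))%:R - (n * d)%:R) * Lambda_coord p 0 k.
Proof. by rewrite !mxE /= mcoeff_pol_h mdeg_box_mnm. Qed.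

End LambdaBasis.

(** * Weight multiplicities of [Lambda n d] as numbers of partitions *)

Section LambdaWeights.
Variables n d : nat.
Local Notation box := (n.-tuple 'I_d.+1).
Implicit Types (t u : box).
Local Notation h := (Lambda_op_h n d).

(** Labels of the basis of weight -i, as h acts in degree j by 2j - nd; the equation is stated
    additively to avoid truncated subtraction. *)
Definition box_wt i : {set box} :=
  [set t in box_all n d | 2 * tsum t + i == n * d]%N.

Lemma tsum_le t : (tsum t <= n * d)%N.
Proof.
rewrite -[n in (n * d)%N]card_ord -sum_nat_const; apply: leq_sum => k _.
by rewrite -ltnS.
Qed.

Lemma Lambda_wtP (a : rat) (p : Lambda n d) :
  h p = a *: p <->
  forall k, (2 * (tsum (enum_val k))%:R - (n * d)%:R - a) * Lambda_coord p 0 k = 0.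
Proof.
split=> [hp k | hp].
  have := Lambda_coord_h p k; rewrite hp linearZ [LHS]mxE => E.
  by rewrite mulrBl -E subrr.
apply: (bij_inj (Lambda_coord_bij n d)); apply/rowP => k.
rewrite Lambda_coord_h linearZ [RHS]mxE; apply/eqP.
by rewrite -subr_eq0 -mulrBl hp.
Qed.

Lemma Lambda_wt_eq0 (a : rat) (p : Lambda n d) :
    h p = a *: p -> (forall t, 2 * (tsum t)%:R - (n * d)%:R != a) -> p = 0.
Proof.
move=> /Lambda_wtP hp na; apply: (bij_inj (Lambda_coord_bij n d)); apply/rowP => k.
have /eqP := hp k; rewrite linear0 [RHS]mxE mulf_eq0 subr_eq0 (negbTE (na _)).
by move/eqP.
Qed.

Lemma Lambda_wt_bound a (p : Lambda n d) :
  (n * d < a)%N -> h p = a%:R *: p -> p = 0.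
Proof.
move=> lt_a /Lambda_wt_eq0; apply=> t; rewrite subr_eq -natrM -natrD eqr_nat.
by have := tsum_le t; lia.
Qed.

Lemma Lambda_wt_bound_neg a (p : Lambda n d) :
  (n * d < a)%N -> h p = - a%:R *: p -> p = 0.
Proof.
move=> lt_a /Lambda_wt_eq0; apply=> t; rewrite subr_eq addrC -subr_eq opprK.
by rewrite -natrM -natrD eqr_nat; lia.
Qed.

Lemma dim_wt_Lambda i : \dim (wt_space h i) = #|box_wt i|.
Proof.
pose S := [set k : 'I_#|box_all n d| | enum_val k \in box_wt i].
rewrite (dim_coord_subspace (Lambda_coord_bij n d) (S := S)).
  rewrite -(card_imset (f := fun k : 'I_#|box_all n d| => enum_val k) S enum_val_inj).
  apply: eq_card => t.
  apply/imsetP/idP => [[k + ->] | tB]; first by rewrite inE.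
  have t_in : t \in box_all n d by move: tB; rewrite inE => /andP[].
  by exists (enum_rank_in t_in t); rewrite ?[_ \in S]in_set enum_rankK_in.
move=> p; rewrite mem_wt_space; have wtE k :
    (2 * (tsum (enum_val k))%:R - (n * d)%:R - - i%:R == 0 :> rat) = (k \in S).
  rewrite in_set [enum_val k \in _]in_set enum_valP /= opprK addrAC subr_eq0.
  by rewrite -natrM -natrD eqr_nat.
split=> [/eqP/Lambda_wtP hp k kS | hp].
  by have /eqP := hp k; rewrite mulf_eq0 wtE (negbTE kS) => /eqP.
apply/eqP/Lambda_wtP => k; apply/eqP; rewrite mulf_eq0 wtE.
by case: (boolP (k \in S)) => //= /hp ->.
Qed.

(** The partitions in [box_wt i] have size (dn - i)/2; when this is not a natural number both sides
    are 0. *)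
Lemma gauss_coef_wt i :
  gauss_coef (d + n) n ((d * n)%:R / 2 - i%:R / 2) = (#|box_wt i|)%:Z.
Proof.
have natE (j : nat) : ((d * n)%:R / 2 - i%:R / 2 == j%:R :> rat) = (2 * j + i == n * d)%N.
  rewrite -mulrBl -(inj_eq (@mulIf rat 2 isT)) divfK // subr_eq -natrM -natrD eqr_nat.
  by rewrite [(d * n)%N]mulnC [(j * 2)%N]mulnC eq_sym.
have [/existsP[j jE] | /existsPn noj] := boolP [exists j : 'I_(n * d).+1, 2 * j + i == n * d]%N.
  move: (jE); rewrite -natE => /eqP->; rewrite gauss_coef_box; congr Posz.
  apply: eq_card => t; rewrite !inE -/(tsum t); congr (_ && _).
  by move: jE => /eqP jE; apply/eqP/eqP; lia.
rewrite /gauss_coef; case: ifP => [/natrP[j /eqP] | _].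
  by rewrite natE => jE; have := noj (inord j); rewrite inordK ?jE //; lia.
apply/esym/eqP; rewrite eqz_nat cards_eq0; apply/eqP/setP => t; rewrite !inE.
have := noj (inord (tsum t)); rewrite inordK ?ltnS ?tsum_le // => /negbTE ->.
by rewrite andbF.
Qed.

Lemma box_allP t :
  reflect {homo tnth t : k l / (k < l)%N >-> (l <= k)%N} (t \in box_all n d).
Proof.
rewrite inE (sorted_pairwise (@geq_ord_trans d)).
apply: (iffP (pairwiseP ord0)) => [tP k l lt_kl | tP k l]; rewrite ?inE ?size_tuple.
  by rewrite !(tnth_nth ord0); apply: tP; rewrite ?inE ?size_tuple.
by move=> lt_k lt_l; have := tP (Ordinal lt_k) (Ordinal lt_l); rewrite !(tnth_nth ord0).
Qed.

(** The complement of a partition in the rectangle. It turns size s into nd - s, and thus exchanges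
    opposite weights. *)
Definition box_rev t : box := [tuple rev_ord (tnth t (rev_ord k)) | k < n].

Lemma box_revK : involutive box_rev.
Proof.
by move=> t; apply: eq_from_tnth => k; rewrite !tnth_mktuple !rev_ordK.
Qed.

Lemma tsum_rev t : (tsum (box_rev t) + tsum t = n * d)%N.
Proof.
rewrite /tsum (reindex_inj rev_ord_inj) -big_split /= -[n in RHS]card_ord.
rewrite -sum_nat_const; apply: eq_bigr => k _.
rewrite tnth_mktuple rev_ordK /= subSS subnK // -ltnS; exact: ltn_ord.
Qed.

Lemma box_rev_in t : (box_rev t \in box_all n d) = (t \in box_all n d).
Proof.
suff imp u : u \in box_all n d -> box_rev u \in box_all n d.
  by apply/idP/idP => /imp //; rewrite box_revK.
move=> /box_allP uP; apply/box_allP => k l lt_kl; rewrite !tnth_mktuple /=.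
by apply/leq_sub2l/uP => /=; have := ltn_ord l; lia.
Qed.

Lemma card_box_wt_rev i :
  #|[set t in box_all n d | 2 * tsum t == n * d + i]%N| = #|box_wt i|.
Proof.
rewrite -(card_preimset _ (can_inj box_revK)); apply: eq_card => t.
rewrite [LHS]in_set [LHS]in_set [RHS]in_set box_rev_in; congr (_ && _).
by have := tsum_rev t; lia.
Qed.

Lemma dim_Lambda :
  \dim {:Lambda n d} = (\dim (wt_space h 0)
    + 2 * \sum_(i < n * d) \dim (wt_space h i.+1))%N.
Proof.
rewrite dimvf -[dim _]/#|box_all n d|.
under eq_bigr do rewrite dim_wt_Lambda.
rewrite dim_wt_Lambda.
(* Each partition has exactly one weight: 0, or -(i+1) or i+1 for a single i < nd. Summing these
   indicators over all partitions gives the dimension. *)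
have split1 t : (1 = (2 * tsum t + 0 == n * d) + \sum_(i < n * d)
    ((2 * tsum t + i.+1 == n * d) + (2 * tsum t == n * d + i.+1)))%N.
  have le_t := tsum_le t; have [eq0 | neq0] := eqVneq (2 * tsum t + 0)%N (n * d)%N.
    by rewrite big1 // => i _; lia.
  have [lt_t | le_N] := ltnP (2 * tsum t) (n * d).
    have lt_i : ((n * d - 2 * tsum t).-1 < n * d)%N by lia.
    rewrite (bigD1 (Ordinal lt_i)) //= big1 => [|i]; first by lia.
    by rewrite -val_eqE /=; lia.
  have lt_i : ((2 * tsum t - n * d).-1 < n * d)%N by lia.
  rewrite (bigD1 (Ordinal lt_i)) //= big1 => [|i]; first by lia.
  by rewrite -val_eqE /=; lia.
have cardE (P : pred box) :
    #|[set t in box_all n d | P t]| = (\sum_(t in box_all n d) P t)%N.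
  rewrite -sum1_card [RHS]big_mkcond [LHS]big_mkcond; apply: eq_bigr => t _.
  by rewrite !inE; case: sorted => //; case: (P t).
rewrite -sum1_card (eq_bigr _ (fun t _ => split1 t)) big_split /= -cardE.
congr (_ + _)%N; rewrite exchange_big big_distrr; apply: eq_bigr => i _ /=.
by rewrite big_split /= -!cardE card_box_wt_rev addnn mul2n.
Qed.

End LambdaWeights.

(** * The decomposition of the module of symmetric polynomials *)

Theorem theorem5 (n d : nat) (n_gt0 : (0 < n)%N) (d_gt0 : (0 < d)%N) :
  [/\ forall i : nat, (i <= n * d)%N -> 0 <= sl2_mult n d i,
      sl2_iso (sl2_Lambda n d)
        (sl2_dsum (fun i : 'I_(n * d).+1 =>
           sl2_copies `|sl2_mult n d i|%N (sl2_V i)))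
    & forall j : nat,
        gauss_coef (d + n) n j%:R = (#|box_partitions d n j|)%:Z].
Proof.
pose w i := \dim (wt_space (Lambda_op_h n d) i).
pose c i := \dim (lowest_space (Lambda_op_h n d) (Lambda_op_em n d) i).
have multE i : sl2_mult n d i = (w i)%:Z - (w i.+2)%:Z.
  rewrite /sl2_mult /w !dim_wt_Lambda -!gauss_coef_wt; congr (_ - gauss_coef _ _ _).
  (* The second index is (dn - i)/2 - 1 = (dn - (i+2))/2, which belongs to weight -i-2. *)
  by rewrite -[i.+2]addn2 natrD; field.
have [_ cE] := dim_lowest_space_eq (@Lambda_hep n d) (@Lambda_hem n d) (@Lambda_epem n d)
  (@Lambda_wt_bound_neg n d) (dim_Lambda n d).
(* The multiplicity is the dimension of a space of lowest weight vectors; so it is nonnegative and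
   equals its absolute value. *)
have mult_c i : (i <= n * d)%N -> sl2_mult n d i = (c i)%:Z.
  by move=> /cE cwi; rewrite multE /w -cwi PoszD addrK.
split; first by move=> i /mult_c ->.
  apply: (@sl2_decomposition _ _ _ _ (@Lambda_hep n d) (@Lambda_hem n d) (@Lambda_epem n d)
    _ (@Lambda_wt_bound n d) (@Lambda_wt_bound_neg n d) (dim_Lambda n d)
    (fun i => `|sl2_mult n d i|%N)) => i le_i.
  by rewrite mult_c // absz_nat cE.
exact: gauss_coef_box.
Qed.
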